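(* Let $(V,g)$ be an inner product vector space over $k$, with $k=\mathbb{R}$ or $k=\mathbb{C}$ (possibly infinite-dimensional). The core order $\leq^{(\#)}$ is a partial order (reflexive, antisymmetric and transitive) on the set $\operatorname{End}_k^{fp}(V)^{\leq 1}$ of finite potent endomorphisms of $V$ of index less than or equal to $1$.
   Context: An endomorphism $\varphi$ of $V$ is finite potent if $\varphi^n(V)$ is finite-dimensional for some $n$. Equivalently, there is a (unique) $\varphi$-invariant decomposition $V=W_\varphi\oplus U_\varphi$ (AST-decomposition) with $\varphi|_{U_\varphi}$ nilpotent, $W_\varphi$ finite-dimensional and $\varphi|_{W_\varphi}$ an automorphism of $W_\varphi$. The index $i(\varphi)$ is the nilpotency order of $\varphi|_{U_\varphi}$; $i(\varphi)\le 1$ iff $W_\varphi=\operatorname{Im}(\varphi)$ iff $U_\varphi=\operatorname{Ker}(\varphi)$. For $\varphi$ finite potent with $i(\varphi)\le 1$ one has $V=\operatorname{Im}(\varphi)\oplus[\operatorname{Im}(\varphi)]^{\perp}$, and the core inverse $\varphi^{(\#)}$ is the unique linear map with $\varphi\circ\varphi^{(\#)}=P_{\operatorname{Im}(\varphi)}$ (the orthogonal projection onto $\operatorname{Im}(\varphi)$ induced by this decomposition) and $\operatorname{Im}(\varphi^{(\#)})\subseteq\operatorname{Im}(\varphi)$. For $\varphi,\psi\in\operatorname{End}_k^{fp}(V)^{\leq 1}$, the core order $\varphi\leq^{(\#)}\psi$ means: $\varphi\circ\varphi^{(\#)}=\psi\circ\varphi^{(\#)}$ and $\varphi^{(\#)}\circ\varphi=\varphi^{(\#)}\circ\psi$.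 *)

(* Defs.v *)
From mathcomp Require Import all_boot all_order all_algebra.
From mathcomp Require Import sesquilinear complex.
From mathcomp Require Import boolp classical_sets functions reals.

Set Implicit Arguments.
Unset Strict Implicit.
Unset Printing Implicit Defensive.

Import GRing.Theory Num.Theory.

Local Open Scope classical_set_scope.
Local Open Scope ring_scope.

Definition partial_order_on (T : Type) (A : set T) (le : T -> T -> Prop) : Prop :=
  [/\ forall x, A x -> le x x,
      forall x y, A x -> A y -> le x y -> le y x -> x = y &
      forall x y z, A x -> A y -> A z -> le x y -> le y z -> le x z].

Section FinitePotent.
Variables (K : fieldType) (V : lmodType K).
Implicit Types (W U : set V) (phi : {linear V -> V}).

Definition span_of n (e : 'I_n -> V) : set V :=
  [set v | exists c : 'I_n -> K, v = \sum_(i < n) c i *: e i].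

Definition finite_dimensional W : Prop :=
  exists n (e : 'I_n -> V), W = span_of e.

Definition finite_potent phi : Prop :=
  exists n, finite_dimensional (range (iter n phi)).

Definition vanishes_on n phi U : Prop := forall u, U u -> iter n phi u = 0.

Definition direct_sum_decomposition W U : Prop :=
  [/\ submod_closed (mem W), submod_closed (mem U),
      forall v, exists w u, [/\ W w, U u & v = w + u] &
      W `&` U = [set 0]].

Record AST_decomposition phi W U : Prop := {
  AST_direct_sum : direct_sum_decomposition W U;
  AST_invariantW : phi @` W `<=` W;
  AST_invariantU : phi @` U `<=` U;
  AST_nilpotent : exists n, vanishes_on n phi U;
  AST_finite_dim : finite_dimensional W;
  AST_automorphism : set_bij W W phi
}.

(* The nilpotency order is the least exponent at which the restriction
   vanishes; it is 0 exactly when U is the zero subspace. *)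
Definition nilpotency_order phi U (n : nat) : Prop :=
  vanishes_on n phi U /\ (forall m, vanishes_on m phi U -> (n <= m)%N).

(* A relation rather than a function: the AST decomposition, hence the index,
   is unique when it exists. *)
Definition has_index phi (n : nat) : Prop :=
  exists W U, AST_decomposition phi W U /\ nilpotency_order phi U n.

Definition finite_potent_index_le1 : set {linear V -> V} :=
  [set phi | finite_potent phi /\ exists2 n, has_index phi n & (n <= 1)%N].

End FinitePotent.
Arguments finite_potent_index_le1 {K} V.

Section CoreOrder.
Variables (K : numFieldType) (theta : K -> K) (V : lmodType K).
Variable g : {dot V for theta}.
Implicit Types (W : set V) (phi psi chi : {linear V -> V}).

Definition orthogonal_complement W : set V :=
  [set v | forall w, W w -> g v w = 0].

(* P maps each v to its W-component in V = W (+) W^perp. *)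
Definition is_orthogonal_projection W (P : V -> V) : Prop :=
  forall v, W (P v) /\ orthogonal_complement W (v - P v).

Definition is_core_inverse phi chi : Prop :=
  is_orthogonal_projection (range phi) (phi \o chi)
  /\ range chi `<=` range phi.

(* On finite potent maps of index at most 1 there is exactly one core inverse
   chi of phi, so the quantifier only names it. *)
Definition core_le phi psi : Prop :=
  exists chi : {linear V -> V},
    [/\ is_core_inverse phi chi,
        phi \o chi = psi \o chi &
        chi \o phi = chi \o psi].

End CoreOrder.

(* Main.v *)
From HB Require Import structures.
Require Import Defs.
From mathcomp Require Import all_boot all_order all_algebra.
From mathcomp Require Import sesquilinear complex reals.
From mathcomp Require Import boolp classical_sets functions.

Local Open Scope ring_scope.

(** If [chi] is the core inverse of [phi], then [chi] inverts [phi] on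
    [range phi] and kills its orthogonal complement. Hence
    [phi <= psi] makes [psi] agree with [phi] on [range phi], makes
    [range phi] a subspace of [range psi], and so lets the core inverse of
    [phi] absorb the orthogonal projection onto [range psi]; transitivity and
    antisymmetry are short computations from these facts. Reflexivity amounts to
    the existence of the core inverse, for which one projects orthogonally onto
    the finite-dimensional range (Gram-Schmidt) and then inverts [phi] there. *)

Import Order.TTheory GRing.Theory Num.Theory.
Local Open Scope classical_set_scope.

(** Nilpotency order at most 1 makes [phi] vanish on [U], so its range is [W], on which it is
    bijective. The last two conclusions are surjectivity and injectivity of [phi] on its range. *)
Lemma index_le1_range (K : fieldType) (V : lmodType K) (phi : {linear V -> V}) :
  finite_potent_index_le1 V phi ->
  [/\ finite_dimensional (range phi),
      forall v, exists u, phi (phi u) = phi v &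
      forall v, phi (phi v) = 0 -> phi v = 0].
Proof.
move=> [_ [n [W [U [ast [vanU _]]]] n_le1]].
case: ast => [[_ _ decV WU0] _ _ _ finW [phiW injW surjW]].
have phiU u : U u -> phi u = 0.
  move=> /vanU; case: n n_le1 {vanU} => [|[|//]] _ //= ->.
  exact: linear0.
have W0 : W 0 by have : [set (0 : V)] 0 by []; rewrite -WU0 => -[].
have range_image v : exists2 w, W w & phi w = phi v.
  have [w [u [Ww Uu ->]]] := decV v.
  by exists w => //; rewrite linearD (phiU u Uu) addr0.
have rangeE : range phi = W.
  apply/seteqP; split => [_ [v _ <-]|w Ww].
    by have [w Ww <-] := range_image v; apply: phiW.
  by have [v _ <-] := surjW w Ww; exists v.
split; first by rewrite rangeE.
- move=> v; have [w Ww <-] := range_image v.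
  by have [u _ <-] := surjW w Ww; exists u.
- move=> v phi2v; apply: injW; rewrite ?inE //.
  + by rewrite -rangeE; exists v.
  + by rewrite linear0.
Qed.

Lemma linear_ext (K : fieldType) (V : lmodType K) (phi psi : {linear V -> V}) :
  phi =1 psi -> phi = psi.
Proof.
case: phi psi => [f [[fB] [fZ]]] [h [[hB] [hZ]]] /= /funext fh.
(* The linearity proofs depend on the underlying map, so the maps are identified first; proof
   irrelevance does the rest. *)
case: _ / fh in hB hZ *.
by rewrite (Prop_irrelevance fB hB) (Prop_irrelevance fZ hZ).
Qed.

Section CoreOrderTheory.
Variables (K : numFieldType) (theta : K -> K) (V : lmodType K).
Variable g : {dot V for theta}.
Implicit Types (W : set V) (phi psi chi : {linear V -> V}).

Lemma dot_eq0 (v : V) : g v v = 0 -> v = 0.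
Proof.
move=> gv0; apply/eqP; apply: contraT => /(neq0_dnorm_gt0 (s := g)).
by rewrite gv0 ltxx.
Qed.

Lemma orthogonal_complementB {W} (u v : V) :
  orthogonal_complement g W u -> orthogonal_complement g W v ->
  orthogonal_complement g W (u - v).
Proof. by move=> Wu Wv w Ww; rewrite linearBl /= Wu // Wv // subrr. Qed.

(** The difference [a - b] lies in the range and is orthogonal to it, hence to itself. *)
Lemma orthogonal_component_unique (phi : {linear V -> V}) (a b v : V) :
  range phi a -> range phi b ->
  orthogonal_complement g (range phi) (v - a) ->
  orthogonal_complement g (range phi) (v - b) -> a = b.
Proof.
move=> [a' _ <-] [b' _ <-] oa ob; apply/eqP; rewrite -subr_eq0; apply/eqP.
apply: dot_eq0.
have := orthogonal_complementB _ _ ob oa.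
by rewrite opprB [X in _ _ X]addrC subrKA -linearB; apply; exists (a' - b').
Qed.

Lemma finite_dimensional_projection W : finite_dimensional W ->
  forall v, exists w, W w /\ orthogonal_complement g W (v - w).
Proof.
move=> [n [e ->]]; elim: n e => [|n IHn] e v.
  exists 0; split; first by exists (fun=> 0); rewrite big_ord0.
  by move=> _ [c ->]; rewrite big_ord0 linear0r.
pose S := span_of (fun i => e (lift ord0 i)).
have [p [Sp op]] := IHn (fun i => e (lift ord0 i)) (e ord0).
have [w [Sw ow]] := IHn (fun i => e (lift ord0 i)) v.
(* [q] is the part of the first vector orthogonal to the span of the others, and [a] the coefficient
   of [v - w] along it. If [q = 0], the division by zero is harmless: every vector is orthogonal to
   [q]. *)
set q := e ord0 - p in op; pose a := g (v - w) q / g q q.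
have orth_q : g (v - w - a *: q) q = 0.
  rewrite linearBl /= linearZl_LR /= /a.
  have [->|q0] := eqVneq q 0; first by rewrite !linear0r mulr0 subr0.
  by rewrite divfK ?subrr // gt_eqF // neq0_dnorm_gt0.
have orth_S s : S s -> g (v - w - a *: q) s = 0.
  by move=> Ss; rewrite linearBl /= linearZl_LR /= ow // op // mulr0 subr0.
exists (w + a *: q); rewrite opprD addrA; split.
  case: Sw Sp => [c ->] [d pE].
  exists (fun i => if unlift ord0 i is Some j then c j - a * d j else a).
  rewrite big_ord_recl unlift_none /q pE scalerBr addrCA; congr (_ + _).
  rewrite scaler_sumr -sumrB; apply: eq_bigr => i _.
  by rewrite liftK scalerBl scalerA.
move=> _ [c ->]; rewrite big_ord_recl linearDr /=.
rewrite (orth_S (\sum_(i < n) _)); last by exists (fun i => c (lift ord0 i)).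
rewrite addr0 linearZr_LR /= -(subrK p (e ord0)) -/q linearDr /= orth_q orth_S //.
by rewrite addr0 mulr0.
Qed.

Lemma core_inverse_exists phi : finite_potent_index_le1 V phi ->
  exists chi, is_core_inverse g phi chi.
Proof.
move=> /index_le1_range[fin_range sq_range phi_inj].
have ex_chi v : exists c, range phi c /\
    orthogonal_complement g (range phi) (v - phi c).
  have [_ [[u _ <-] ou]] := finite_dimensional_projection _ fin_range v.
  by have [u' u'E] := sq_range u; exists (phi u'); rewrite u'E; split.
have uniq_chi v a b : range phi a -> range phi b ->
    orthogonal_complement g (range phi) (v - phi a) ->
    orthogonal_complement g (range phi) (v - phi b) -> a = b.
  move=> [a' _ <-] [b' _ <-] oa ob; apply/eqP; rewrite -subr_eq0 -linearB.
  apply/eqP/phi_inj; rewrite !linearB; apply/eqP; rewrite subr_eq0; apply/eqP.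
  exact: (orthogonal_component_unique phi _ _ v).
have [f fP] := choice ex_chi.
(* Linearity follows from uniqueness: [a *: f u + f v] has the properties that characterise
   [f (a *: u + v)]. *)
have f_lin : linear f.
  move=> a u v.
  have [[fu' _ fuE] ou] := fP u; have [[fv' _ fvE] ov] := fP v.
  have [rf of_] := fP (a *: u + v).
  apply: (uniq_chi _ _ _ rf) of_ _.
    by exists (a *: fu' + fv') => //; rewrite linearP fuE fvE.
  move=> w rw; rewrite linearP opprD addrACA -scalerBr.
  by rewrite linearDl /= linearZl_LR /= ou // ov // mulr0 addr0.
pose chi : {linear V -> V} := HB.pack f (GRing.isLinear.Build _ _ _ _ f f_lin).
exists chi; split=> [v|_ [v _ <-]]; last exact: (fP v).1.
by split; [exists (f v)|exact: (fP v).2].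
Qed.

Section CoreInverseTheory.
Variables phi chi : {linear V -> V}.
Hypothesis phi_inj : forall v, phi (phi v) = 0 -> phi v = 0.
Hypothesis phi_chi : is_core_inverse g phi chi.

Lemma core_inverseK (v : V) : phi (chi (phi v)) = phi v.
Proof.
apply: (orthogonal_component_unique phi _ _ (phi v)).
- by exists (chi (phi v)).
- by exists v.
- exact: (phi_chi.1 (phi v)).2.
- by move=> w _; rewrite subrr linear0l.
Qed.

Lemma core_inverse_range (v : V) : exists u, chi v = phi u.
Proof. by have [|u _ uE] := phi_chi.2 (chi v); [exists v|exists u]. Qed.

(** Both sides lie in [range phi], where [phi] is injective, and they have the same image because
    [phi \o chi] fixes the range. *)
Lemma core_inverse_phiK (v : V) : chi (phi (phi v)) = phi v.
Proof.
have [u uE] := core_inverse_range (phi (phi v)).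
apply/eqP; rewrite -subr_eq0 uE -linearB; apply/eqP/phi_inj.
by rewrite !linearB -uE core_inverseK subrr.
Qed.

Lemma core_inverse_orthogonal (v : V) :
  orthogonal_complement g (range phi) v -> chi v = 0.
Proof.
move=> ov; have [u uE] := core_inverse_range v.
rewrite uE; apply: phi_inj; rewrite -uE.
apply: (orthogonal_component_unique phi _ _ v).
- by exists (chi v).
- by exists 0; rewrite ?linear0.
- exact: (phi_chi.1 v).2.
- by rewrite subr0.
Qed.

Lemma core_le_agree psi : phi \o chi = psi \o chi ->
  forall v, psi (phi v) = phi (phi v).
Proof.
move=> pcE v; have pc u : phi (chi u) = psi (chi u) := congr1 (@^~ u) pcE.
by rewrite -[in LHS]core_inverse_phiK -pc core_inverse_phiK.
Qed.

Lemma core_le_range psi : phi \o chi = psi \o chi ->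
  range phi `<=` range psi.
Proof.
move=> pcE _ [v _ <-]; exists (chi (phi v)) => //.
by rewrite -[psi _](congr1 (@^~ (phi v)) pcE) /= core_inverseK.
Qed.

End CoreInverseTheory.

Lemma core_le_partial_order :
  partial_order_on (finite_potent_index_le1 V) (core_le g).
Proof.
split.
- by move=> phi /core_inverse_exists[chi chiP]; exists chi.
- move=> phi psi Aphi Apsi [X [XP pX Xp]] [Y [YP qY _]].
  have [_ _ phi_inj] := index_le1_range _ _ _ Aphi.
  have Xpsi v : X (phi v) = X (psi v) := congr1 (@^~ v) Xp.
  have psi_phi := core_le_range _ _ YP _ qY.
  (* The projection [phi \o X] fixes [phi v] and also [psi v], which lies in [range phi]; and [X]
     takes the same value on both. *)
  have phiE v : phi v = psi v.
    have [|u _ uE] := psi_phi (psi v); first by exists v.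
    by rewrite -(core_inverseK _ _ XP) Xpsi -uE (core_inverseK _ _ XP).
  exact: linear_ext.
- move=> phi psi rho Aphi Apsi _ [X [XP pX Xp]] [Y [YP qY Yq]].
  have [_ _ phi_inj] := index_le1_range _ _ _ Aphi.
  have [_ _ psi_inj] := index_le1_range _ _ _ Apsi.
  have range_le := core_le_range _ _ XP _ pX.
  have rho_psi := core_le_agree _ _ psi_inj YP _ qY.
  exists X; split => //; apply/funext => v /=.
    rewrite [LHS](congr1 (@^~ v) pX) /=.
    (* [X v] lies in [range phi], hence in [range psi], where [rho] and [psi] agree. *)
    have [u ->] := core_inverse_range _ _ XP v.
    have [|w _ <-] := range_le (phi u); first by exists u.
    by rewrite rho_psi.
  (* The projection of [rho v] onto [range psi] is [psi (Y (rho v)) = psi (Y (psi v)) = psi v]. So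
     [rho v - psi v] is orthogonal to [range psi], hence to [range phi], and [X] kills it. *)
  rewrite [LHS](congr1 (@^~ v) Xp) /=.
  apply/eqP; rewrite eq_sym -subr_eq0 -linearB; apply/eqP.
  apply: (core_inverse_orthogonal _ _ phi_inj XP) => w /range_le rw.
  have := (YP.1 (rho v)).2 w rw.
  by rewrite /= -[Y (rho v)](congr1 (@^~ v) Yq) /= (core_inverseK _ _ YP).
Qed.

End CoreOrderTheory.

Theorem theorem5p8 (R : realType) :
  (forall (V : lmodType R) (g : {dot V for idfun}),
     partial_order_on (finite_potent_index_le1 V) (core_le g)) /\
  (forall (V : lmodType R[i]) (g : {dot V for Num.conj}),
     partial_order_on (finite_potent_index_le1 V) (core_le g)).
Proof.
by split=> V g; apply: core_le_partial_order.
Qed.
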